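(* There is a function $c(d)$ depending only on $d$, with $c(d)=2^{O(d)}$ (singly exponential in $d$), such that the following holds. Let $\|\cdot\|$ be an arbitrary norm on $\mathbb{R}^d$, let $X\subset\mathbb{R}^d$ be finite, and let $\mathcal{C}_1,\ldots,\mathcal{C}_{|X|}$ be the clusterings computed by the agglomerative radius algorithm on input $X$ (with any tie-breaking strategy). Then for all $k\in\mathbb{N}$ with $k\leq|X|$, \[\mathrm{radcost}(\mathcal{C}_k)\leq c(d)\,(1+\log k)\cdot\mathrm{opt}_k,\] i.e. $\mathrm{radcost}(\mathcal{C}_k)=O(\log k)\cdot\mathrm{opt}_k$, where $\mathrm{opt}_k$ is the minimum of $\mathrm{radcost}(\mathcal{C})$ over all $k$-clusterings $\mathcal{C}$ of $X$.
   Context: A $k$-clustering of a finite set $X$ is a partition of $X$ into $k$ non-empty sets (clusters). For finite non-empty $C\subset\mathbb{R}^d$, $\mathrm{rad}(C)=\min_{y\in\mathbb{R}^d}\max_{x\in C}\|x-y\|$, and $\mathrm{radcost}(\mathcal{C})=\max_{C\in\mathcal{C}}\mathrm{rad}(C)$. The agglomerative radius algorithm: start with $\mathcal{C}_{|X|}=\{\{x\}:x\in X\}$; for $i=|X|-1,\ldots,1$, choose distinct clusters $A,B\in\mathcal{C}_{i+1}$ minimizing $\mathrm{rad}(A\cup B)$ and set $\mathcal{C}_i=(\mathcal{C}_{i+1}\setminus\{A,B\})\cup\{A\cup B\}$; output $\mathcal{C}_1,\ldots,\mathcal{C}_{|X|}$. *)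

(* Defs.v *)
From HB Require Import structures.
From mathcomp Require Import all_boot all_order all_algebra finmap.
From mathcomp Require Import all_classical all_reals all_analysis.

Set Implicit Arguments.
Unset Strict Implicit.
Unset Printing Implicit Defensive.

Import Order.TTheory GRing.Theory Num.Theory.
Import numFieldNormedType.Exports.

Local Open Scope classical_set_scope.
Local Open Scope ring_scope.

(* The norm is an explicit function: the norm `|x| that the library puts on
   'rV[R]_d is the sup norm only. *)
Definition is_norm (R : realType) (d : nat) (N : 'rV[R]_d -> R) : Prop :=
  [/\ forall x y, N (x + y) <= N x + N y,
      forall (a : R) x, N (a *: x) = `|a| * N x
    & forall x, N x = 0 -> x = 0].

Definition is_clustering (T : choiceType) (X : {fset T}) (k : nat)
    (P : {fset {fset T}}) : Prop :=
  [/\ fcover P = X, trivIfset P, fset0 \notin P & #|` P| = k].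

Section Radius.
Variables (R : realType) (d : nat) (N : 'rV[R]_d -> R).
Implicit Types (C A B : {fset 'rV[R]_d}) (P : {fset {fset 'rV[R]_d}}).

(* Starting the maximum at 0 is harmless for nonempty C, as norms are
   nonnegative. *)
Definition max_dist C (y : 'rV[R]_d) : R :=
  \big[Num.max/0]_(x <- C) N (x - y).

(* For a norm N this infimum is a minimum, since y |-> max_dist C y is then
   continuous and coercive on a finite-dimensional space. *)
Definition radius C : R := inf [set max_dist C y | y in [set: 'rV[R]_d]].

Definition radcost P : R := \big[Num.max/0]_(C <- P) radius C.

(* There are finitely many k-clusterings of X, and at least one when
   1 <= k <= #|` X|; the infimum is then a minimum. *)
Definition opt (X : {fset 'rV[R]_d}) (k : nat) : R :=
  inf [set radcost P | P in [set P | is_clustering X k P]].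

Definition merge_step P P' : Prop :=
  exists A B, [/\ A \in P, B \in P, A != B,
    forall A' B', A' \in P -> B' \in P -> A' != B' ->
      radius (A `|` B)%fset <= radius (A' `|` B')%fset
    & P' = ((A `|` B) |` (P `\` [fset A; B]))%fset].

(* Cs i is the clustering with i clusters; only the values at
   1 <= i <= #|` X| are constrained.  Ties may be broken arbitrarily, and
   differently at each step. *)
Definition agglomerative_run (X : {fset 'rV[R]_d})
    (Cs : nat -> {fset {fset 'rV[R]_d}}) : Prop :=
  Cs #|` X| = [fset [fset x]%fset | x in X]%fset /\
  forall i, (0 < i < #|` X|)%N -> merge_step (Cs i.+1) (Cs i).

End Radius.

(* c(d) = 2^{O(d)} *)
Definition singly_exponential (R : realType) (c : nat -> R) : Prop :=
  exists2 f : nat -> R,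
    f =O_\oo (fun d => d%:R : R) & forall d, c d = 2 `^ f d.

(* Main.v *)
(* Fix r > opt and a k-clustering O of cost < r.  At threshold t, consider the
   clustering reached just before the first merge of cost >= t: its clusters have
   radius < t, and any two of them have a union of radius >= t.
   Between thresholds s < t, every cluster that is not already present at s
   consists of at least two clusters of threshold s.  So if at most b clusters
   survive unchanged, a count q becomes at most (q + b) / 2.

   For S a subfamily of O, apply this to the clusters contained in the union
   of S.  For t + r = (1 + 2^-j)(s + r), the survivors meeting one optimal cluster
   have (2^-j (s + r))-separated centers in a ball of radius s + r, so
   b = 2^O(jd) #|S|.  Using O(d) rounds at each of the levels j = ..., 1, 0 and
   then O(d) rounds t + r = 3 (s + r), with b = #|S|, the count drops to 2 #|S| at
   a threshold tau = 2^O(d) r, for all S simultaneously.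

   From then on, raising the threshold by an additive 2 (tau + r) leaves at most k
   survivors, so the excess over k of the number of clusters halves, and it
   vanishes after O(log k) rounds. *)
Require Import Defs.
From mathcomp Require Import all_boot all_order all_algebra finmap.
From mathcomp Require Import all_classical all_reals all_analysis.
From mathcomp Require Import zify ring lra.

Set Implicit Arguments.
Unset Strict Implicit.
Unset Printing Implicit Defensive.

Import Order.TTheory GRing.Theory Num.Theory.

Local Open Scope ring_scope.

Local Notation radius := Defs.radius.

(** * Comparison of an arbitrary norm with the sup norm *)

Section Norm.
Import numFieldNormedType.Exports.
Local Open Scope classical_set_scope.
Variables (R : realType) (d : nat) (N : 'rV[R]_d -> R).
Hypothesis Nn : is_norm N.

Lemma is_normD x y : N (x + y) <= N x + N y.
Proof. by case: Nn. Qed.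

Lemma is_normZ a x : N (a *: x) = `|a| * N x.
Proof. by case: Nn. Qed.

Lemma is_norm0 : N 0 = 0.
Proof. by rewrite -(scale0r 0) is_normZ normr0 mul0r. Qed.

Lemma is_normN x : N (- x) = N x.
Proof. by rewrite -scaleN1r is_normZ normrN1 mul1r. Qed.

Lemma is_normB x y : N (x - y) = N (y - x).
Proof. by rewrite -is_normN opprB. Qed.

Lemma is_norm_ge0 x : 0 <= N x.
Proof. by have := is_normD x (- x); rewrite subrr is_norm0 is_normN; lra. Qed.

Lemma is_norm_gt0 x : x != 0 -> 0 < N x.
Proof.
move=> x0; rewrite lt_def is_norm_ge0 andbT; apply: contra x0 => /eqP Nx.
by case: Nn => _ _ N0; rewrite (N0 _ Nx).
Qed.

Lemma is_norm_triangle y x z : N (x - z) <= N (x - y) + N (y - z).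
Proof. by rewrite -(subrKA y x) is_normD. Qed.

Lemma coord_le_norm (x : 'rV[R]_d) (j : 'I_d) : `|x ord0 j| <= `|x|.
Proof.
have /mapP[i Hi ->] : `|x ord0 j| \in [seq `|x k.1 k.2| | k : 'I_1 * 'I_d].
  by apply/mapP; exists (ord0, j) => //=; rewrite mem_enum.
by rewrite [leRHS]/Num.Def.normr /= mx_normrE; apply/bigmax_geP; right => /=; exists i.
Qed.

Lemma is_norm_ub : exists2 K : R, 0 < K & forall x, N x <= K * `|x|.
Proof.
exists (1 + \sum_j N (delta_mx 0 j)).
  by rewrite ltr_pwDl // sumr_ge0 // => j _; exact: is_norm_ge0.
move=> x.
have Nsum (I : Type) (s : seq I) (F : I -> 'rV[R]_d) :
    N (\sum_(i <- s) F i) <= \sum_(i <- s) N (F i).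
  elim/big_rec2: _ => [|i u v _ uv]; first by rewrite is_norm0.
  by rewrite (le_trans (is_normD _ _)) // lerD2l.
rewrite mulrDl mul1r {1}(row_sum_delta x) (le_trans (Nsum _ _ _)) //.
rewrite mulr_suml ler_wpDl // ler_sum // => j _.
by rewrite is_normZ mulrC ler_wpM2l ?is_norm_ge0 // coord_le_norm.
Qed.

Lemma is_norm_continuous : continuous (N : 'rV[R]_d -> R^o).
Proof.
have [K K0 NK] := is_norm_ub.
move=> x; apply/(@cvgrPdist_lt R R^o _ _ (nbhs_filter x)) => e e0.
have eK : 0 < e / K by rewrite divr_gt0.
apply: (@filterS _ _ (nbhs_filter x) _ _ _ (nbhsx_ballx x (e / K) eK)) => y.
rewrite -ball_normE /= => xy.
have NB : `|N x - N y| <= N (x - y).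
  have := is_norm_triangle y x 0; have := is_norm_triangle x y 0.
  by rewrite !subr0 (is_normB y x) ler_norml; lra.
apply: le_lt_trans NB _; apply: le_lt_trans (NK _) _.
by rewrite mulrC -ltr_pdivlMr.
Qed.

(** By compactness [N] attains its minimum on the sup-norm unit sphere; it is positive there, and
    homogeneity carries the bound to every vector. *)
Lemma is_norm_lb : exists2 c : R, 0 < c & forall x, c * `|x| <= N x.
Proof.
pose S := [set x : 'rV[R]_d | `|x| = 1].
have [[s Ss]|S0] := pselect (S !=set0); last first.
  exists 1 => // x; rewrite mul1r; have [->|x0] := eqVneq x 0.
    by rewrite normr0 is_norm_ge0.
  exfalso; apply: S0; exists (`|x|^-1 *: x).
  by rewrite /S /= normrZ normfV normr_id mulVf // normr_eq0.
have cS : compact S.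
  apply: bounded_closed_compact.
    exists 1; split=> [|M M1 x Sx]; first exact: num_real. by rewrite /= Sx ltW.
  apply: (@closed_comp _ _ (fun x : 'rV[R]_d => `|x|) [set 1 : R]).
    by move=> x _; exact: norm_continuous.
  exact: closed_eq.
have [||x Sx xmin] := compact_EVT_min _ cS (f := N).
- by exists s.
- exact/continuous_subspaceT/is_norm_continuous.
rewrite inE in Sx.
exists (N x).
  by apply: is_norm_gt0; rewrite -normr_eq0 [X in X != 0]Sx oner_eq0.
move=> y; have [->|y0] := eqVneq y 0; first by rewrite normr0 mulr0 is_norm_ge0.
have ny : 0 < `|y| by rewrite normr_gt0.
have : N x <= N (`|y|^-1 *: y).
  by apply: xmin; rewrite inE /S /= normrZ normfV normr_id mulVf ?normr_eq0.
by rewrite is_normZ normfV normr_id ler_pdivlMl // mulrC.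
Qed.

End Norm.

(** * Packing of separated points in a ball *)

Lemma exp_ratio_unbounded (m K : nat) :
  exists n, (K * m ^ n < m.+1 ^ n)%N.
Proof.
exists (K * m).+1.
(* Bernoulli's inequality [(1 + 1/m)^i >= 1 + i/m], with denominators cleared. *)
have bernoulli i : (m ^ i * m + i * m ^ i <= m.+1 ^ i * m)%N.
  elim: i => [|i IH]; first by rewrite !expn0 mul0n addn0.
  by rewrite !expnS; nia.
have [->|m0] := posnP m; first by rewrite muln0 !expn1 muln0.
have := bernoulli (K * m).+1; have : (0 < m ^ (K * m).+1)%N by rewrite expn_gt0 m0.
nia.
Qed.

Section Packing.
Variables (R : realType) (d : nat) (N : 'rV[R]_d -> R).
Hypothesis Nn : is_norm N.

(** Rounding coordinates to a grid of step [h] is injective, since two points in one cell are at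
    distance at most [K * h = delta / 2]. The constant [C] depends on the norm but not on [n];
    [packing] exploits only the growth in [n]. *)
Lemma separated_card_le (rho delta : R) : 0 <= rho -> 0 < delta ->
  exists C : nat, forall (n : nat) (T : finType) (p : T -> 'rV[R]_d),
    (0 < n)%N -> (forall i, N (p i) <= rho * n%:R) ->
    (forall i j, i != j -> delta <= N (p i - p j)) -> (#|T| <= (C * n) ^ d)%N.
Proof.
move=> rho0 delta0.
have [c c0 cN] := is_norm_lb Nn; have [K K0 NK] := is_norm_ub Nn.
pose h := delta / (2 * K); have h0 : 0 < h by rewrite divr_gt0 ?mulr_gt0.
pose C := (Num.truncn (2 * rho / (c * h))).+1.
exists C => n T p n0 pub psep.
pose w (i : T) (j : 'I_d) : R := (p i ord0 j + rho * n%:R / c) / h.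
have pcoord i j : `|p i ord0 j| <= rho * n%:R / c.
  rewrite ler_pdivlMr // mulrC (le_trans _ (pub i)) // (le_trans _ (cN _)) //.
  by rewrite ler_wpM2l ?coord_le_norm // ltW.
have w0 i j : 0 <= w i j.
  rewrite divr_ge0 ?(ltW h0) //.
  by have := pcoord i j; rewrite ler_norml; lra.
have wub i j : (Num.truncn (w i j) < C * n)%N.
  rewrite truncn_lt_nat // natrM.
  apply: (@le_lt_trans _ _ (2 * rho / (c * h) * n%:R)); last first.
    by rewrite ltr_pM2r ?ltr0n // truncnS_gt.
  have -> : 2 * rho / (c * h) * n%:R = (2 * (rho * n%:R / c)) / h.
    by field; rewrite !gt_eqF.
  rewrite ler_pM2r ?invr_gt0 //.
  by have := pcoord i j; rewrite ler_norml; lra.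
pose f (i : T) := [ffun j : 'I_d => Ordinal (wub i j)].
have finj : injective f.
  move=> i j fij; apply/eqP; apply: contraT => /psep; rewrite leNgt.
  suff -> : N (p i - p j) < delta by [].
  apply: le_lt_trans (NK _) _.
  apply: (@le_lt_trans _ _ (K * h)); last first.
    have -> : K * h = delta / 2 by rewrite /h; field; rewrite gt_eqF.
    lra.
  rewrite ler_wpM2l ?(ltW K0) //.
  rewrite /Num.Def.normr /= mx_normrE; apply/bigmax_leP; split; first exact: ltW.
  move=> [a l] _ /=; rewrite (ord1 a) !mxE.
  have /(congr1 (fun g : {ffun 'I_d -> 'I_(C * n)} => val (g l))) := fij.
  rewrite /= !ffunE /= => eqt.
  have /andP[l1 u1] := truncn_itv (w0 i l); have /andP[l2 u2] := truncn_itv (w0 j l).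
  rewrite -eqt in l2 u2.
  have : `|w i l - w j l| <= 1.
    by rewrite -!natr1 in u1 u2; rewrite ler_norml; lra.
  have -> : w i l - w j l = (p i ord0 l - p j ord0 l) / h.
    by rewrite /w; field; rewrite !gt_eqF.
  by rewrite normrM normfV (gtr0_norm h0) ler_pdivrMr // mul1r.
have := leq_card f finj.
by rewrite card_ffun !card_ord.
Qed.

(* From M points p_l in the ball of radius rho, the M^n points
   [m^(n-1) p_(l_1) + ... + p_(l_n)] are still delta-separated, and lie in a
   ball of radius O(m^n): so M^n = O(m^(n d)) for all n, hence M <= m^d.  This
   replaces a comparison of volumes. *)
Lemma packing (rho delta : R) (m : nat) (T : finType) (p : T -> 'rV[R]_d)
    (y : 'rV[R]_d) :
  0 < delta -> (1 < m)%N -> 2 * rho <= delta * (m%:R - 1) ->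
  (forall i, N (p i - y) <= rho) ->
  (forall i j, i != j -> delta <= N (p i - p j)) ->
  (#|T| <= m ^ d)%N.
Proof.
move=> delta0 m1 rhodelta pub psep.
have m1R : 2 <= m%:R :> R by rewrite ler_nat.
have [rho0|rho0] := ltP rho 0.
  rewrite (@eq_card0 _ T) // => i; have := pub i; have := is_norm_ge0 Nn (p i - y).
  by move: rho0; lra.
have [C cardC] := separated_card_le rho0 delta0.
have iterp n : exists (U : finType) (q : U -> 'rV[R]_d),
    [/\ #|U| = (#|T| ^ n)%N,
        forall i, N (q i) <= rho * (m ^ n)%:R - rho
      & forall i j, i != j -> delta <= N (q i - q j)].
  elim: n => [|n [U [q [cU qub qsep]]]].
    exists unit, (fun=> 0); split; first by rewrite card_unit.
      by move=> _; rewrite is_norm0 // expn0 mulr1 subrr.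
    by case=> [] [].
  exists (U * T)%type, (fun a => m%:R *: q a.1 + (p a.2 - y)); split.
  - by rewrite card_prod cU expnSr.
  - move=> [a b] /=; apply: le_trans (is_normD Nn _ _) _.
    rewrite is_normZ // ger0_norm ?ler0n // expnS natrM.
    have := qub a; have := pub b; move: m1R rho0.
    set A := N _; set B := N _; set E := (m ^ n)%:R; set M := m%:R => *.
    nra.
  - move=> [a b] [a' b'] /= ne.
    have -> : m%:R *: q a + (p b - y) - (m%:R *: q a' + (p b' - y)) =
              m%:R *: (q a - q a') + (p b - p b').
      by rewrite scalerBr opprD !opprB !addrA; apply/rowP => j; rewrite !mxE; lra.
    have [aa|aa] := eqVneq a a'.
      rewrite aa subrr scaler0 add0r; apply: psep.
      by apply: contra ne => /eqP ->; rewrite aa.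
    (* Distinct leading terms contribute at least [m * delta], the others take away at most
       [2 * rho], and [m * delta - 2 * rho >= delta]. *)
    have := is_norm_triangle Nn (p b' - p b) (m%:R *: (q a - q a')) 0.
    rewrite !subr0 opprB is_normZ // ger0_norm ?ler0n //.
    have := is_norm_triangle Nn y (p b') (p b); rewrite (is_normB Nn y).
    have := pub b; have := pub b'; have := qsep _ _ aa.
    set A := N _; set B := N _; set D := N _; set E := N _; set F := N _.
    by move: rhodelta m1R; set M := m%:R => *; nra.
rewrite leqNgt; apply/negP => mT.
have [n] := exp_ratio_unbounded (m ^ d) (C ^ d).
have [U [q [cU qub qsep]]] := iterp n.
have /(_ _) := cardC (m ^ n)%N U q _ _ qsep; rewrite cU => card_le.
have : (#|T| ^ n <= (C * m ^ n) ^ d)%N.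
  apply: card_le => [|i]; first by rewrite expn_gt0 (ltnW m1).
  by have := qub i; lra.
rewrite expnMn -!expnM (mulnC n) => le1 lt1.
have := leq_ltn_trans le1 lt1; rewrite ltnNge => /negP; apply.
by case: (n) => // n'; rewrite leq_exp2r.
Qed.
End Packing.

(** * Counting in finite families of sets *)

Section FsetCombinatorics.
Local Open Scope fset_scope.

Lemma in_fset_filter (U : choiceType) (A : {fset U}) (p : pred U) x :
  (x \in [fset a in A | p a]) = (x \in A) && p x.
Proof. by rewrite !inE. Qed.

Lemma leq_card_classes (I U : choiceType) (S : {fset I}) (A : {fset U})
    (rel : I -> U -> bool) (b : nat) :
  {in A, forall a, exists2 i, i \in S & rel i a} ->
  {in S, forall i, #|` [fset a in A | rel i a]| <= b}%N ->
  (#|` A| <= #|` S| * b)%N.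
Proof.
move=> Acov Sb.
have subU : A `<=` \bigcup_(i <- S) [fset a in A | rel i a].
  apply/fsubsetP => a aA; have [i iS ia] := Acov a aA.
  by apply/bigfcupP; exists i; rewrite ?iS // !inE aA.
apply: leq_trans (fsubset_leq_card subU) _.
apply: (@leq_trans (\sum_(i <- S) #|` [fset a in A | rel i a]|)%N).
  elim/big_rec2: _ => [|i n B _ le_n]; first by rewrite cardfs0.
  by rewrite cardfsU (leq_trans (leq_subr _ _)) // leq_add2l.
rewrite big_seq (leq_trans (leq_sum _ Sb)) // -big_seq big_const_seq.
by rewrite count_predT iter_addn_0 mulnC.
Qed.

(** Every [A] in [Q'] contains a member of [Q], and two distinct ones if [A] is not itself in [Q].
    Disjointness within [Q'] keeps all the chosen members apart. *)
Lemma refinement_card (T : choiceType) (Q Q' : {fset {fset T}}) :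
  {in Q' &, forall A B, A != B -> [disjoint A & B]} ->
  {in Q', forall A, A != fset0} ->
  {in Q', forall A x, x \in A -> exists B, [/\ B \in Q, x \in B & B `<=` A]} ->
  (#|` Q'| + #|` Q' `\` Q| <= #|` Q|)%N.
Proof.
move=> disj ne children.
have twoch (A : {fset T}) : exists BB : {fset T} * {fset T}, A \in Q' ->
    [/\ BB.1 \in Q, BB.2 \in Q, BB.1 != fset0 /\ BB.1 `<=` A,
        BB.2 != fset0 /\ BB.2 `<=` A & A \notin Q -> BB.1 != BB.2].
  have [AQ'|AQ'] := boolP (A \in Q'); last by exists (A, A).
  have /fset0Pn[x xA] := ne A AQ'; have [B [BQ xB BA]] := children A AQ' x xA.
  have B0 : B != fset0 by apply/fset0Pn; exists x.
  have [AQ|AQ] := boolP (A \in Q); first by exists (B, B).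
  (* As [B] is in [Q] and [A] is not, [B] misses a point [y] of [A]; the child around [y] is a
     second one. *)
  have /fsubsetPn[y yA yB] : ~~ (A `<=` B).
    by apply: contra AQ => AB; have /eqP -> : A == B by rewrite eqEfsubset AB BA.
  have [B' [B'Q yB' B'A]] := children A AQ' y yA.
  exists (B, B'); split => //=.
    by split => //; apply/fset0Pn; exists y.
  by move=> _; apply: contra yB => /eqP ->.
have [f Pf] := choice twoch.
have same (A A' B B' : {fset T}) : A \in Q' -> A' \in Q' -> B != fset0 -> B `<=` A ->
    B' `<=` A' -> B = B' -> A = A'.
  move=> AQ AQ' /fset0Pn[x xB] /fsubsetP BA /fsubsetP BA' eB.
  apply/eqP; apply: contraT => /(disj _ _ AQ AQ') /fdisjointP /(_ x (BA x xB)).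
  by rewrite BA' // -eB.
have inj1 : {in Q' &, injective (fun A => (f A).1)}.
  move=> A A' AQ AQ' /=.
  have [_ _ [n s] _ _] := Pf A AQ; have [_ _ [_ s'] _ _] := Pf A' AQ'.
  exact: same.
have inj2 : {in Q' `\` Q &, injective (fun A => (f A).2)}.
  move=> A A' /fsetDP[AQ _] /fsetDP[AQ' _] /=.
  have [_ _ _ [n s] _] := Pf A AQ; have [_ _ _ [_ s'] _] := Pf A' AQ'.
  exact: same.
rewrite -(card_in_imfset imfset_key inj1) -(card_in_imfset imfset_key inj2).
set F1 := imfset _ _ _; set F2 := imfset _ _ _.
have -> : (#|` F1| + #|` F2| = #|` F1 `|` F2|)%N.
  rewrite cardfsU; have -> : F1 `&` F2 = fset0; last by rewrite cardfs0 subn0.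
  apply/eqP/fset0Pn => -[B]; rewrite inE => /andP[/imfsetP[A /= AQ ->]].
  move=> /imfsetP[A' /= /fsetDP[AQ' A'Q] eB].
  have [_ _ [n s] _ _] := Pf A AQ; have [_ _ _ [_ s'] ne2] := Pf A' AQ'.
  have eA : A = A' := same _ _ _ _ AQ AQ' n s s' eB.
  by have := ne2 A'Q; rewrite -eB eA eqxx.
apply: fsubset_leq_card; apply/fsubsetP => B; rewrite inE => /orP[] /imfsetP[A /=].
  by move=> AQ ->; have [] := Pf A AQ.
by move=> /fsetDP[AQ _] ->; have [] := Pf A AQ.
Qed.

End FsetCombinatorics.

(** * Partitions and their behaviour under merging *)

Section Clusterings.
Local Open Scope fset_scope.
Variables (T : choiceType) (X : {fset T}).

Lemma clustering_cover k P x :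
  is_clustering X k P -> x \in X -> exists2 A, A \in P & x \in A.
Proof.
by case=> <- _ _ _ /bigfcupP[A /andP[AP _] xA]; exists A.
Qed.

Lemma clustering_sub k P A : is_clustering X k P -> A \in P -> A `<=` X.
Proof.
case=> <- _ _ _ AP; apply/fsubsetP => x xA.
by apply/bigfcupP; exists A; rewrite ?AP.
Qed.

Lemma clustering_neq0 k P A : is_clustering X k P -> A \in P -> A != fset0.
Proof. by case=> _ _ P0 _; apply: contraTneq => ->. Qed.

Lemma clustering_disjoint k P A B : is_clustering X k P ->
  A \in P -> B \in P -> A != B -> [disjoint A & B].
Proof. by case=> _ /trivIfsetP disj _ _ AP BP; exact: disj. Qed.

Lemma clustering_eq k P A B x : is_clustering X k P ->
  A \in P -> B \in P -> x \in A -> x \in B -> A = B.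
Proof.
move=> clP AP BP xA xB; apply/eqP; apply: contraT.
by move=> /(clustering_disjoint clP AP BP) /fdisjointP /(_ x xA); rewrite xB.
Qed.

Lemma singletons_clustering :
  is_clustering X #|` X| [fset [fset x] | x in X].
Proof.
split.
- apply/fsetP => x; apply/bigfcupP/idP => [[A /andP[/imfsetP[y /= yX ->] _]]|xX].
    by rewrite inE => /eqP ->.
  by exists [fset x]; rewrite ?inE // andbT in_imfset.
- apply/trivIfsetP => _ _ /imfsetP[x /= _ ->] /imfsetP[y /= _ ->] xy.
  by apply/fdisjointP => z; rewrite !inE => /eqP ->; apply: contra xy => /eqP ->.
- by apply/imfsetP => -[x _ /fsetP /(_ x)]; rewrite !inE eqxx.
- by rewrite card_imfset //; exact: fset1_inj.
Qed.

Lemma merge_clustering k P A B : is_clustering X k.+1 P ->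
  A \in P -> B \in P -> A != B ->
  is_clustering X k ((A `|` B) |` (P `\` [fset A; B])).
Proof.
move=> clP AP BP AB; have [cov _ P0 cardP] := clP.
(* The count drops by exactly one because the union is new: an old cluster sharing a point with [A]
   would be [A]. *)
have notin : A `|` B \notin P `\` [fset A; B].
  rewrite !inE !negb_or; apply/negP => /andP[/andP[neA _] ABP].
  have /fset0Pn[x xA] := clustering_neq0 clP AP.
  case/negP: neA; apply/eqP; apply: (clustering_eq (x := x) clP) => //.
  by rewrite inE xA.
split.
- rewrite -cov; apply/fsetP => x; apply/bigfcupP/bigfcupP.
    move=> [C]; rewrite andbT !inE => /orP[/eqP ->|/andP[_ CP] xC]; last first.
      by exists C; rewrite ?CP.
    by rewrite inE => /orP[] xx; [exists A|exists B]; rewrite ?AP ?BP.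
  move=> [C]; rewrite andbT => CP xC.
  have [CAB|CAB] := boolP (C \in [fset A; B]).
    exists (A `|` B); first by rewrite !inE eqxx.
    by move: CAB; rewrite !inE => /orP[] /eqP <-; rewrite xC ?orbT.
  by exists C => //; rewrite andbT inE; apply/orP; right; rewrite inE CAB.
- have disjU C : C \in P `\` [fset A; B] -> [disjoint A `|` B & C].
    rewrite !inE negb_or => /andP[/andP[CA CB] CP].
    by rewrite fdisjointUX !(clustering_disjoint clP) 1?eq_sym.
  apply/trivIfsetP => C D; rewrite 2!in_fset1U.
  move=> /orP[/eqP ->|CP] /orP[/eqP ->|DP] CD.
  + by rewrite eqxx in CD.
  + exact: disjU.
  + by rewrite fdisjoint_sym disjU.
  + by apply: (clustering_disjoint clP) => //; [move: CP|move: DP]; case/fsetDP.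
- rewrite !inE negb_or (negbTE P0) andbF andbT; apply/negP => /eqP U0.
  have /fset0Pn[x xA] := clustering_neq0 clP AP.
  by have /fsetP /(_ x) := U0; rewrite !inE xA.
- have sub : [fset A; B] `<=` P.
    by apply/fsubsetP => C; rewrite !inE => /orP[] /eqP ->.
  rewrite cardfsU1 notin (cardfsDS sub) cardP.
  by have := fsubset_leq_card sub; rewrite cardP cardfs2 AB /=; lia.
Qed.

End Clusterings.

(** * Radius and cost below a strict threshold *)

Lemma bigmax_seq_ltP (R : realDomainType) (I : eqType) (s : seq I) (F : I -> R) (t : R) :
  0 < t -> (\big[Num.max/0]_(x <- s) F x < t) <-> (forall x, x \in s -> F x < t).
Proof.
move=> t0; split=> [ltt x xs|ltt].
  by apply: le_lt_trans ltt; exact: Order.TotalTheory.le_bigmax_seq.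
rewrite big_seq; elim/big_rec: _ => // x y xs yt.
by rewrite gt_max ltt.
Qed.

Section Radius.
Local Open Scope fset_scope.
Variables (R : realType) (d : nat) (N : 'rV[R]_d -> R).

Lemma max_dist_ge0 C y : 0 <= max_dist N C y.
Proof.
rewrite /max_dist; elim/big_rec: _ => // x v _ v0.
by rewrite le_max v0 orbT.
Qed.

(** An infimum is below [t] exactly when some value is, so a strict inequality hands over an actual
    center; thresholds are strict for this reason. *)
Lemma radius_ltP C t : 0 < t ->
  radius N C < t <-> exists y, forall x, x \in C -> N (x - y) < t.
Proof.
move=> t0; have mdP y := @bigmax_seq_ltP R _ (enum_fset C) (fun x => N (x - y)) t t0.
split=> [/inf_lt[|_ [y _ <-] /mdP ylt]|[y /mdP ylt]].
- by exists (max_dist N C 0), 0.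
- by exists y.
- apply: le_lt_trans ylt; apply: inf_lbound; last by exists y.
  by exists 0 => _ [z _ <-]; exact: max_dist_ge0.
Qed.

Lemma radius_lt_subset C C' t : 0 < t ->
  C `<=` C' -> radius N C' < t -> radius N C < t.
Proof.
move=> t0 /fsubsetP sCC' /(radius_ltP _ t0)[y ylt].
by apply/(radius_ltP _ t0); exists y => x /sCC' /ylt.
Qed.

Lemma radcost_ltP P t : 0 < t ->
  radcost N P < t <-> {in P, forall C, radius N C < t}.
Proof. exact: bigmax_seq_ltP. Qed.

Lemma radcost_ge0 P : 0 <= radcost N P.
Proof.
rewrite /radcost; elim/big_rec: _ => // x v _ v0.
by rewrite le_max v0 orbT.
Qed.

End Radius.

(** * Thresholds along a run *)

Section Run.
Local Open Scope fset_scope.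
Variables (R : realType) (d : nat) (N : 'rV[R]_d -> R) (X : {fset 'rV[R]_d}).
Variable Cs : nat -> {fset {fset 'rV[R]_d}}.
Hypotheses (Nn : is_norm N) (run : agglomerative_run N X Cs).

Lemma run_clustering i : (0 < i <= #|` X|)%N -> is_clustering X i (Cs i).
Proof.
case: run => init step.
suff H j : (j < #|` X|)%N -> is_clustering X (#|` X| - j) (Cs (#|` X| - j)).
  move=> /andP[i0 iX]; have := H (#|` X| - i)%N; rewrite subKn //; apply.
  by rewrite -subn_gt0 subKn.
elim: j => [|j IH] jX; first by rewrite subn0 init; exact: singletons_clustering.
have /IH : (j < #|` X|)%N by exact: ltnW.
have -> : (#|` X| - j = (#|` X| - j.+1).+1)%N by lia.
have /step[A [B [AP BP AB _ ->]]] : (0 < #|` X| - j.+1 < #|` X|)%N by lia.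
by move=> clP; exact: merge_clustering.
Qed.

Lemma run_refine i j B : (0 < i <= j)%N -> (j <= #|` X|)%N -> B \in Cs j ->
  exists2 A, A \in Cs i & B `<=` A.
Proof.
case: run => _ step /andP[i0 ij].
elim: j ij B => [|j IH] ij B jX BP; first by move: i0; rewrite ltnNge ij.
move: ij; rewrite leq_eqVlt => /orP[/eqP ->|ij]; first by exists B.
have {}ij : (i <= j)%N by lia.
have /step[A1 [A2 [_ _ _ _ Cj]]] : (0 < j < #|` X|)%N by lia.
have [B' B'P BB'] : exists2 B', B' \in Cs j & B `<=` B'.
  rewrite Cj; have [BA|BA] := boolP (B \in [fset A1; A2]).
    exists (A1 `|` A2); first by rewrite !inE eqxx.
    by move: BA; rewrite !inE => /orP[] /eqP ->; [exact: fsubsetUl|exact: fsubsetUr].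
  by exists B => //; rewrite in_fset1U inE BA BP orbT.
have [A AP B'A] := IH ij B' (ltnW jX) B'P.
by exists A => //; exact: fsubset_trans BB' B'A.
Qed.

Hypothesis X0 : (0 < #|` X|)%N.

(* The fewest clusters the run reaches using clusters of radius < t only. *)
Definition stage (t : R) : nat :=
  (find (fun i => radcost N (Cs i.+1) < t) (iota 0 #|` X|)).+1.

Section Stage.
Variable t : R.
Hypothesis t0 : 0 < t.

Lemma radcost_singletons : radcost N (Cs #|` X|) < t.
Proof.
case: run => -> _; apply/radcost_ltP => // _ /imfsetP[x _ ->].
apply/radius_ltP => //; exists x => y; rewrite inE => /eqP ->.
by rewrite subrr is_norm0.
Qed.

Lemma has_stage : has (fun i => radcost N (Cs i.+1) < t) (iota 0 #|` X|).
Proof.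
apply/hasP; exists #|` X|.-1; first by rewrite mem_iota; lia.
by rewrite prednK //; exact: radcost_singletons.
Qed.

Lemma stage_le_card : (0 < stage t <= #|` X|)%N.
Proof. by rewrite /stage; have := has_stage; rewrite has_find size_iota. Qed.

Lemma stage_clustering : is_clustering X (stage t) (Cs (stage t)).
Proof. exact/run_clustering/stage_le_card. Qed.

Lemma stage_radius A : A \in Cs (stage t) -> radius N A < t.
Proof.
have := nth_find 0%N has_stage; rewrite nth_iota ?add0n.
  by move=> /radcost_ltP; exact.
by have := stage_le_card; rewrite /stage; lia.
Qed.

Lemma stage_min i : (0 < i <= #|` X|)%N -> radcost N (Cs i) < t -> (stage t <= i)%N.
Proof.
case: i => // i /= iX it; rewrite ltnNge; apply/negP => lei.
have := before_find 0%N (lei : (i < find _ _)%N).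
by rewrite nth_iota // add0n it.
Qed.

(* The merge leaving this stage creates a cluster of radius at least t, and it
   is the cheapest merge available. *)
Lemma stage_merge_ge A B : A \in Cs (stage t) -> B \in Cs (stage t) -> A != B ->
  t <= radius N (A `|` B).
Proof.
move=> AP BP AB; have [_ _ _ cardP] := stage_clustering.
have /andP[s0 sX] := stage_le_card.
have s1 : (1 < stage t)%N.
  rewrite -cardP; have := cardfs2 A B; rewrite AB /= => <-.
  by apply: fsubset_leq_card; apply/fsubsetP => C; rewrite !inE => /orP[] /eqP ->.
case: run => _ /(_ (stage t).-1) []; first by lia.
rewrite prednK // => A' [B' [A'P B'P A'B' minAB eP]].
rewrite leNgt; apply/negP => ABt.
have mt : radius N (A' `|` B') < t.
  by apply: le_lt_trans ABt; exact: minAB.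
have : (stage t <= (stage t).-1)%N; last by lia.
apply: stage_min; first by lia.
rewrite eP; apply/radcost_ltP => // C; rewrite in_fset1U => /orP[/eqP -> //|].
by move=> /fsetDP[CP _]; exact: stage_radius.
Qed.

End Stage.

Lemma stage_le s t : 0 < s -> s <= t -> (stage t <= stage s)%N.
Proof.
move=> s0 st; have t0 := lt_le_trans s0 st; apply: stage_min => //.
  exact: stage_le_card.
by apply/radcost_ltP => // C /(stage_radius s0) /lt_le_trans; apply.
Qed.

Lemma stage_refine s t B : 0 < s -> s <= t -> B \in Cs (stage s) ->
  exists2 A, A \in Cs (stage t) & B `<=` A.
Proof.
move=> s0 st; apply: run_refine.
  by rewrite stage_le // andbT; have /andP[] := stage_le_card (lt_le_trans s0 st).
by have /andP[] := stage_le_card s0.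
Qed.

Lemma stage_radcost t k : 0 < t -> (stage t <= k <= #|` X|)%N ->
  radcost N (Cs k) < t.
Proof.
move=> t0 /andP[sk kX]; apply/radcost_ltP => // B BP.
have [|A AP BA] := run_refine _ kX BP (i := stage t).
  by rewrite sk andbT; have /andP[] := stage_le_card t0.
exact: radius_lt_subset t0 BA (stage_radius t0 AP).
Qed.

End Run.

(** * Halving recursions and a bounded product *)

Lemma iter_halving (q : nat -> nat) (b n : nat) :
  (forall i, 2 * q i.+1 <= q i + b)%N -> (2 ^ n * q n <= q 0 + 2 ^ n * b)%N.
Proof.
move=> halve; elim: n => [|n IH]; first by rewrite !expn0 !mul1n leq_addr.
by have := halve n; rewrite expnS; nia.
Qed.

(* By induction, the product over j < J is at most 6 (1 - 2^(1-J)) for J >= 2. *)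
Lemma prod_1Dexp2N_le (R : realType) (J : nat) :
  \prod_(j < J) (1 + 2^-1 ^+ j) <= 6 :> R.
Proof.
have p0 (i : nat) : 0 < 2^-1 ^+ i :> R by rewrite exprn_gt0.
have H j : \prod_(i < j.+2) (1 + 2^-1 ^+ i) <= 6 * (1 - 2^-1 ^+ j.+1) :> R.
  elim: j => [|j IH].
    by rewrite !big_ord_recr big_ord0 /= expr0 expr1; lra.
  rewrite big_ord_recr /=.
  have := p0 j.+1; rewrite (exprS _ j.+1); set P := \prod_(i < _) _ in IH *.
  by set x := 2^-1 ^+ j.+1 in IH * => x0; nra.
case: J => [|[|J]]; first by rewrite big_ord0; lra.
  by rewrite big_ord_recr big_ord0 /= expr0; lra.
by apply: le_trans (H J) _; have := p0 J.+1; lra.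
Qed.

(** * Counting clusters between two thresholds *)

Section Analysis.
Local Open Scope fset_scope.
Local Open Scope ring_scope.
Variables (R : realType) (d : nat) (N : 'rV[R]_d -> R) (X : {fset 'rV[R]_d}).
Variable Cs : nat -> {fset {fset 'rV[R]_d}}.
Hypotheses (Nn : is_norm N) (run : agglomerative_run N X Cs).
Hypothesis X0 : (0 < #|` X|)%N.
Variables (k : nat) (r : R) (Os : {fset {fset 'rV[R]_d}}).
Hypotheses (r0 : 0 < r) (clOs : is_clustering X k Os) (Os_lt : radcost N Os < r).

Let P_ (t : R) := Cs (stage N X Cs t).
(* Children of an inside cluster are inside: this lets the count be localised to
   any subfamily S of the optimal clusters. *)
Let inside (t : R) (S : {fset {fset 'rV[R]_d}}) :=
  [fset A in P_ t | A `<=` fcover S].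
Let hits (O A : {fset 'rV[R]_d}) := ~~ [disjoint A & O]%fset.

Let clP t : 0 < t -> is_clustering X (stage N X Cs t) (P_ t).
Proof. by move=> t0; exact: stage_clustering. Qed.

Lemma hitsP O A : reflect (exists2 x, x \in A & x \in O) (hits O A).
Proof.
apply: (iffP idP) => [/fset0Pn[x]|[x xA xO]].
  by rewrite inE => /andP[xA xO]; exists x.
by apply/fset0Pn; exists x; rewrite inE xA.
Qed.

(** By [stage_refine] each cluster at [t] is a union of clusters at [s], as [refinement_card] asks;
    [Q] has to contain those lying inside members of [Q']. *)
Lemma stage_card s t Q Q' : 0 < s -> s <= t -> Q' `<=` P_ t ->
  (forall A B, A \in Q' -> B \in P_ s -> B `<=` A -> B \in Q) ->
  (#|` Q'| + #|` Q' `\` Q| <= #|` Q|)%N.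
Proof.
move=> s0 st /fsubsetP sub closed; have t0 := lt_le_trans s0 st.
apply: refinement_card.
- move=> A B /sub AP /sub BP; exact: clustering_disjoint (clP t0) AP BP.
- move=> A /sub AP; exact: clustering_neq0 (clP t0) AP.
move=> A AQ x xA.
have /fsubsetP/(_ x xA) xX := clustering_sub (clP t0) (sub A AQ).
have [B BP xB] := clustering_cover (clP s0) xX.
have [A' A'P BA'] := stage_refine Nn run X0 s0 st BP.
have eA : A' = A.
  apply: (clustering_eq (x := x) (clP t0)) => //; first exact: sub.
  by move/fsubsetP: BA'; exact.
rewrite eA in BA'.
by exists B; split => //; exact: closed BA'.
Qed.

Lemma stage_card2 s t Q Q' : 0 < s -> s <= t -> Q' `<=` P_ t ->
  (forall A B, A \in Q' -> B \in P_ s -> B `<=` A -> B \in Q) ->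
  (2 * #|` Q'| <= #|` Q| + #|` Q' `&` Q|)%N.
Proof.
move=> s0 st sub closed; have := stage_card s0 st sub closed.
by have := cardfsID Q Q'; lia.
Qed.

Lemma inside_card2 s t S : 0 < s -> s <= t ->
  (2 * #|` inside t S| <= #|` inside s S| + #|` inside t S `&` inside s S|)%N.
Proof.
move=> s0 st; apply: (stage_card2 s0 st).
  by apply/fsubsetP => A; rewrite !inE => /andP[].
move=> A B; rewrite !inE => /andP[_ AS] BP BA.
by rewrite BP (fsubset_trans BA AS).
Qed.

Lemma inside_hits t S A : 0 < t -> A \in inside t S -> exists2 O, O \in S & hits O A.
Proof.
move=> t0; rewrite !inE => /andP[AP /fsubsetP AS].
have /fset0Pn[x xA] := clustering_neq0 (clP t0) AP.
have /bigfcupP[C] := AS x xA; rewrite andbT => CS xC.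
by exists C => //; apply/hitsP; exists x.
Qed.

(** The center [y] of [B] serves the union: going from a point of [A] via the center of [A] to a
    point of [O], then via the center of [O] to a point of [B] and on to [y] costs less than
    [2 * a + 2 * r + b]. Distinct clusters at [t] admit no such union. *)
Lemma shared_opt_eq (t a b : R) O A B : 0 < a -> 0 < b -> 2 * a + b + 2 * r <= t ->
  A \in P_ t -> B \in P_ t -> radius N A < a -> radius N B < b ->
  O \in Os -> hits O A -> hits O B -> A = B.
Proof.
move=> a0 b0 tle AP BP /(radius_ltP _ _ a0)[x xA] /(radius_ltP _ _ b0)[y yB] OOs.
move=> /hitsP[z zA zO] /hitsP[w wB wO].
have t0 : 0 < t by move: r0; lra.
have /(radius_ltP _ _ r0)[q qO] : radius N O < r by move/radcost_ltP: Os_lt; exact.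
apply/eqP; apply: contraT => /(stage_merge_ge Nn run X0 t0 AP BP); rewrite leNgt.
suff -> : radius N (A `|` B) < t by [].
apply/radius_ltP => //; exists y => p; rewrite inE => /orP[pA|/yB]; last first.
  by move: r0; lra.
have := is_norm_triangle Nn x p y; have := is_norm_triangle Nn z x y.
have := is_norm_triangle Nn q z y; have := is_norm_triangle Nn w q y.
have := xA p pA; have := xA z zA; have := qO z zO; have := qO w wO; have := yB w wB.
by rewrite (is_normB Nn x z) (is_normB Nn q w); lra.
Qed.

Lemma cardfs_le1 (U : choiceType) (A : {fset U}) :
  {in A &, forall a b, a = b} -> (#|` A| <= 1)%N.
Proof.
move=> all_eq; have [->|[a aA]] := fset_0Vmem A; first by rewrite cardfs0.
rewrite -(cardfs1 a); apply: fsubset_leq_card; apply/fsubsetP => b bA.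
by rewrite inE (all_eq b a).
Qed.

(** The threshold is [2 * s + s + 2 * r], so by [shared_opt_eq] each optimal cluster meets at most
    one unmerged cluster. In the variable [t + r] this is multiplication by 3. *)
Lemma inside_tripling s S : 0 < s -> S `<=` Os ->
  (2 * #|` inside (3 * s + 2 * r) S| <= #|` inside s S| + #|` S|)%N.
Proof.
move=> s0 /fsubsetP SOs; set t := 3 * s + 2 * r.
have st : s <= t by move: r0; rewrite /t; lra.
apply: leq_trans (inside_card2 S s0 st) _; rewrite leq_add2l -[leqRHS]muln1.
apply: (leq_card_classes (rel := hits)).
  move=> A /fsetIP[_ AS]; exact: inside_hits AS.
move=> O OS; apply: cardfs_le1 => A B; rewrite !inE /=.
move=> /andP[/andP[/andP[AP _] /andP[APs _]] OA] /andP[/andP[/andP[BP _] /andP[BPs _]] OB].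
apply: (shared_opt_eq s0 s0) AP BP _ _ (SOs _ OS) OA OB.
- by rewrite /t; lra.
- exact (stage_radius Nn run X0 s0 APs).
- exact (stage_radius Nn run X0 s0 BPs).
Qed.

(** Centers of unmerged clusters meeting one optimal cluster lie within [s + r] of its center. Two
    of them closer than [e * (s + r)] would let a ball around one, of radius below [t], cover both
    clusters: too cheap a merge at [t]. *)
Lemma inside_packing s j S : 0 < s -> S `<=` Os ->
  (2 * #|` inside (s + 2^-1 ^+ j * (s + r)) S|
     <= #|` inside s S| + #|` S| * (2 ^ (j + 2)) ^ d)%N.
Proof.
move=> s0 /fsubsetP SOs; set e := 2^-1 ^+ j; set t := s + _.
have e0 : 0 < e by rewrite exprn_gt0.
have st : s <= t by rewrite lerDl mulr_ge0 ?(ltW e0) // addr_ge0 // ltW.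
have t0 := lt_le_trans s0 st.
apply: leq_trans (inside_card2 S s0 st) _; rewrite leq_add2l.
apply: (leq_card_classes (rel := hits)).
  move=> A /fsetIP[_ AS]; exact: inside_hits AS.
move=> O OS; set W := [fset A in _ | _].
have WP A : A \in W -> [/\ A \in P_ t, A \in P_ s & hits O A].
  by rewrite !inE => /andP[/andP[/andP[-> _] /andP[-> _]] ->].
have cent (A : {fset 'rV[R]_d}) :
    exists c, A \in W -> forall x, x \in A -> N (x - c) < s.
  have [/WP[_ AP _]|] := boolP (A \in W); last by exists 0.
  by have /(radius_ltP _ _ s0)[c cA] := stage_radius Nn run X0 s0 AP; exists c.
have [c cP] := choice cent.
have /(radius_ltP _ _ r0)[q qO] : radius N O < r.
  by move/radcost_ltP: Os_lt; apply => //; exact: SOs.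
rewrite cardfE.
have := @packing R d N Nn (s + r) (e * (s + r)) (2 ^ (j + 2)) W (fun A => c (val A)) q.
(* Taking [m = 4 / e] in [packing] asks for [2 <= 4 - e], which [e <= 1] ensures. *)
have e2 : e * (2 ^ (j + 2))%:R = 4.
  rewrite natrX exprD mulrA -exprMn mulVf ?pnatr_eq0 // expr1n mul1r.
  by rewrite expr2; lra.
have e1 : e <= 1 by rewrite exprn_ile1 // invf_le1 // ler1n.
apply.
- by rewrite mulr_gt0 // addr_gt0.
- by rewrite -[X in (X < _)%N](expn0 2) ltn_exp2l // addn2.
- rewrite mulrBr mulr1 mulrAC e2; move: r0 s0 e1; nra.
- move=> A; have AW := valP A; have [_ _ /hitsP[x xA xO]] := WP _ AW.
  have := is_norm_triangle Nn x (c (val A)) q; rewrite (is_normB Nn (c _) x).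
  by have := cP _ AW x xA; have := qO x xO; lra.
- move=> A B AB; have [AP _ _] := WP _ (valP A); have [BP _ _] := WP _ (valP B).
  rewrite leNgt; apply/negP => lt_e.
  have := stage_merge_ge Nn run X0 t0 AP BP; rewrite leNgt => /(_ AB)/negP; apply.
  apply/radius_ltP => //; exists (c (val A)) => x; rewrite inE => /orP[xA|xB].
    exact: lt_le_trans (cP _ (valP A) x xA) st.
  have := is_norm_triangle Nn (c (val B)) x (c (val A)).
  rewrite (is_normB Nn (c (val B))); have := cP _ (valP B) x xB.
  by rewrite /t; move: lt_e; set E := e * _; lra.
Qed.

(* The recursions are linear in u = t + r, not in the threshold t. *)
Let cnt (S : {fset {fset 'rV[R]_d}}) (u : R) : nat := #|` inside (u - r) S|.

(** With [b] as in the proof, the count starts at most [2^(d+2) * b], so [d.+2] halvings of the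
    excess over [b] leave at most [2 * b]. The exponent [d.+1], rather than the [d] of packing,
    keeps each power at least its base even for [d = 0], as used in [cnt_initial]. *)
Lemma cnt_descend j u S : r < u -> S `<=` Os ->
  (cnt S u <= 2 * (#|` S| * (2 ^ (j + 3)) ^ d.+1))%N ->
  (cnt S ((1 + 2^-1 ^+ j) ^+ d.+2 * u) <= 2 * (#|` S| * (2 ^ (j + 2)) ^ d.+1))%N.
Proof.
move=> ru SOs cu; set e := 1 + _; set b := (#|` S| * _)%N.
have e1 : 1 <= e by rewrite lerDl exprn_ge0.
pose q i := cnt S (e ^+ i * u).
have u0 : 0 < u := lt_trans r0 ru.
have halve i : (2 * q i.+1 <= q i + b)%N.
  have ru' : 0 < e ^+ i * u - r.
    by rewrite subr_gt0 (lt_le_trans ru) // ler_peMl ?(ltW u0) // exprn_ege1.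
  have := inside_packing j ru' SOs; rewrite subrK.
  have -> : e ^+ i * u - r + 2^-1 ^+ j * (e ^+ i * u) = e ^+ i.+1 * u - r.
    by rewrite exprS /e; ring.
  move=> /leq_trans; apply; rewrite leq_add2l leq_mul2l; apply/orP; right.
  by rewrite leq_pexp2l ?leqnSn // expn_gt0.
have := iter_halving d.+2 halve; rewrite {2}/q expr0 mul1r.
rewrite -/(q d.+2) (expnS 2 d.+1); move: cu.
have -> : (#|` S| * (2 ^ (j + 3)) ^ d.+1 = 2 ^ d.+1 * b)%N.
  by rewrite /b addnS (expnS 2 (j + 2)) expnMn mulnCA.
have x0 : (0 < 2 ^ d.+1)%N by rewrite expn_gt0.
move=> cu qle; rewrite -(leq_pmul2l x0) -(leq_pmul2l (isT : 0 < 2)%N).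
by rewrite mulnA (leq_trans qle) //; nia.
Qed.

(** A level equal to the number of points is fine enough to start from: [2 ^ n] exceeds [n], and
    there are never more clusters than points. *)
Lemma cnt_initial S : S `<=` Os ->
  (cnt S (2 * r) <= 2 * (#|` S| * (2 ^ (#|` X| + 2)) ^ d.+1))%N.
Proof.
move=> SOs; rewrite /cnt; have -> : 2 * r - r = r by ring.
have [S0|[C OS]] := fset_0Vmem S.
  suff -> : inside r S = fset0 by rewrite cardfs0.
  apply/eqP; apply: contraT => /fset0Pn[A AS].
  by have [C] := inside_hits r0 AS; rewrite S0.
have S1 : (0 < #|` S|)%N by rewrite cardfs_gt0; apply/fset0Pn; exists C.
apply: (@leq_trans #|` X|).
  have [_ _ _ cardP] := clP r0; have /andP[_ sX] := stage_le_card Nn run X0 r0.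
  rewrite (leq_trans _ sX) // -cardP fsubset_leq_card //.
  by apply/fsubsetP => A; rewrite !inE => /andP[].
have l1 := ltn_expl #|` X| (isT : 1 < 2)%N.
have l2 : (2 ^ #|` X| <= 2 ^ (#|` X| + 2))%N by rewrite leq_exp2l // leq_addr.
have l3 : (2 ^ (#|` X| + 2) <= (2 ^ (#|` X| + 2)) ^ d.+1)%N.
  by rewrite -[leqLHS]expn1 leq_pexp2l // expn_gt0.
by have := leq_trans l2 l3; nia.
Qed.

(** The largest index is the finest level and comes first; level 0, handled last, leaves the base
    [2 ^ 2 = 4]. *)
Lemma cnt_descend_all J u : r < u ->
  (forall S, S `<=` Os -> (cnt S u <= 2 * (#|` S| * (2 ^ (J + 2)) ^ d.+1))%N) ->
  forall S, S `<=` Os ->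
    (cnt S ((\prod_(j < J) (1 + 2^-1 ^+ j)) ^+ d.+2 * u)
       <= 2 * (#|` S| * 4 ^ d.+1))%N.
Proof.
elim: J u => [|J IH] u ru cu S SOs.
  by rewrite big_ord0 expr1n mul1r; exact: cu.
rewrite big_ord_recr /= exprMn -mulrA; apply: IH => //.
  rewrite (lt_le_trans ru) // ler_peMl ?(ltW (lt_trans r0 ru)) //.
  by rewrite exprn_ege1 // lerDl exprn_ge0.
move=> S' S'Os; apply: cnt_descend => //.
by rewrite addnS -addSn; exact: cu.
Qed.

(** The starting factor [2 * 4^(d+1)] equals [2^(2(d+1)+1)], whence the number of rounds. *)
Lemma cnt_tripling u S : r < u -> S `<=` Os ->
  (cnt S u <= 2 * (#|` S| * 4 ^ d.+1))%N ->
  (cnt S (3 ^+ (2 * d.+1).+1 * u) <= 2 * #|` S|)%N.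
Proof.
move=> ru SOs cu; have u0 : 0 < u := lt_trans r0 ru.
pose q i := cnt S (3 ^+ i * u).
have halve i : (2 * q i.+1 <= q i + #|` S|)%N.
  have ru' : 0 < 3 ^+ i * u - r.
    by rewrite subr_gt0 (lt_le_trans ru) // ler_peMl ?(ltW u0) // exprn_ege1 // ler1n.
  have := inside_tripling ru' SOs.
  by have -> : 3 * (3 ^+ i * u - r) + 2 * r = 3 ^+ i.+1 * u - r by rewrite exprS; ring.
have := iter_halving (2 * d.+1).+1 halve; rewrite {2}/q expr0 mul1r.
rewrite -/(q _) (expnS 2 (2 * _)) (expnM 2 2) -[(2 ^ 2)%N]/4%N; move: cu.
have x0 : (0 < 4 ^ d.+1)%N by rewrite expn_gt0.
move=> cu qle; rewrite -(leq_pmul2l x0) -(leq_pmul2l (isT : 0 < 2)%N).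
by rewrite mulnA (leq_trans qle) //; nia.
Qed.

(** The number of levels grows with [X], but the product [p] stays at most 6, so [v / r] is bounded
    in terms of [d] alone. *)
Lemma saturation : exists2 v : R,
  r < v <= 3 ^+ (2 * d.+1).+1 * (6 ^+ d.+2 * (2 * r)) &
  forall S, S `<=` Os -> (cnt S v <= 2 * #|` S|)%N.
Proof.
pose p : R := \prod_(j < #|` X|) (1 + 2^-1 ^+ j).
have p1 : 1 <= p.
  rewrite /p; elim/big_rec: _ => // j x _ x1.
  by rewrite mulr_ege1 // lerDl exprn_ge0.
have r2 : r < 2 * r by move: r0; lra.
have ru : r < p ^+ d.+2 * (2 * r).
  by rewrite (lt_le_trans r2) // ler_peMl ?exprn_ege1 // mulr_ge0 // ltW.
exists (3 ^+ (2 * d.+1).+1 * (p ^+ d.+2 * (2 * r))).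
  apply/andP; split.
    rewrite (lt_le_trans ru) // ler_peMl ?exprn_ege1 ?ler1n //.
    exact: ltW (lt_trans r0 ru).
  rewrite ler_wpM2l ?exprn_ge0 // ler_wpM2r ?mulr_ge0 ?(ltW r0) //.
  by rewrite lerXn2r ?nnegrE ?(le_trans ler01 p1) // prod_1Dexp2N_le.
move=> S SOs; apply: cnt_tripling => //.
by apply: cnt_descend_all => // S'; exact: cnt_initial.
Qed.

(** * Logarithmically many rounds down to [k] clusters *)

Section Final.
Variable v : R.
Hypotheses (rv : r < v) (cntv : forall S, S `<=` Os -> (cnt S v <= 2 * #|` S|)%N).
Let tau := v - r.
Let tau0 : 0 < tau. Proof. by rewrite subr_gt0. Qed.

(* The clusters unmerged between thresholds s and s + 2v are either unmerged
   since tau, and then no optimal cluster meets two of them, or made of at least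
   two clusters of threshold tau, all inside the union of the family S2 of
   optimal clusters that the former miss; by saturation there are at most #|S2|
   of the latter. *)
Lemma unmerged_card s : tau <= s ->
  (#|` P_ (s + 2 * v) `&` P_ s| <= k)%N.
Proof.
move=> taus; have s0 := lt_le_trans tau0 taus; set t := s + 2 * v.
(* In this form [t] matches [shared_opt_eq] with [a = tau] and [b = s]. *)
have ttau : t = s + 2 * tau + 2 * r by rewrite /t /tau; ring.
have taut : tau <= t by rewrite ttau; move: r0 tau0; lra.
set W := _ `&` _; rewrite -(cardfsID (P_ tau) W).
set tiny := W `&` _; set old := W `\` _.
pose S1 := [fset C in Os | has (hits C) tiny]; pose S2 := Os `\` S1.
have S1Os : S1 `<=` Os by apply/fsubsetP => C; rewrite !inE => /andP[].
have S2Os : S2 `<=` Os by exact: fsubsetDl.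
have WP A : A \in W -> A \in P_ t /\ radius N A < s.
  by move=> /fsetIP[At As]; split => //; exact: (stage_radius Nn run X0 s0 As).
have tinyP A : A \in tiny -> A \in P_ t /\ radius N A < tau.
  by move=> /fsetIP[/fsetIP[At _] Atau]; split => //; exact: (stage_radius Nn run X0 tau0 Atau).
have Ohits A x : A \in P_ t -> x \in A -> exists2 C, C \in Os & x \in C.
  move=> At xA; apply: (clustering_cover clOs).
  by have /fsubsetP := clustering_sub (clP (lt_le_trans tau0 taut)) At; apply.
have tiny_le : (#|` tiny| <= #|` S1|)%N.
  rewrite -[leqRHS]muln1; apply: (leq_card_classes (rel := hits)).
    move=> A AT; have [At _] := tinyP A AT.
    have /fset0Pn[x xA] := clustering_neq0 (clP (lt_le_trans tau0 taut)) At.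
    have [C OOs xO] := Ohits A x At xA.
    have OA : hits C A by apply/hitsP; exists x.
    by exists C => //; rewrite !inE OOs; apply/hasP; exists A.
  move=> C OS; apply: cardfs_le1 => A B.
  rewrite !in_fset_filter => /andP[AT OA] /andP[BT OB].
  have [At Ar] := tinyP A AT; have [Bt Br] := tinyP B BT.
  apply: (shared_opt_eq tau0 tau0 _ At Bt Ar Br _ OA OB).
    by rewrite ttau; move: taus; lra.
  by move/fsubsetP: S1Os; apply.
have old_le : (2 * #|` old| <= 2 * #|` S2|)%N.
  apply: leq_trans (cntv S2Os); rewrite mul2n -addnn.
  have oldsub : old `<=` P_ t.
    by apply/fsubsetP => A /fsetDP[/fsetIP[]].
  (* No member of [old] exists at [tau], so removing [inside tau S2] from [old] changes nothing and
     [stage_card] counts [old] twice. *)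
  have -> : (#|` old| + #|` old| = #|` old| + #|` old `\` inside tau S2|)%N.
    congr (_ + #|` _|)%N; apply/fsetP => A; rewrite [RHS]in_fsetD.
    case: (boolP (A \in old)) => [|_]; last by rewrite andbF.
    by rewrite andbT => /fsetDP[_ /negbTE Atau]; rewrite !inE Atau.
  apply: (stage_card tau0 taut oldsub) => A B AT BP BA.
  rewrite !inE BP /=; apply: fsubset_trans BA _.
  have /fsetDP[AW Atau] := AT; have [At Ar] := WP A AW.
  apply/fsubsetP => x xA; have [C OOs xO] := Ohits A x At xA.
  apply/bigfcupP; exists C => //; rewrite andbT /S2 in_fsetD OOs andbT.
  apply/negP; rewrite !inE => /andP[_ /hasP[T TT OT]].
  have [Tt Tr] := tinyP T TT.
  (* An optimal cluster meeting both the tiny [T] and [A] forces them to be equal, yet [A] is absent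
     at [tau]. *)
  have eT : T = A.
    apply: (shared_opt_eq tau0 s0 _ Tt At Tr Ar OOs OT).
      by rewrite ttau; lra.
    by apply/hitsP; exists x.
  by move: Atau; rewrite -eT; move/fsetIP: TT => [_ ->].
have [_ _ _ <-] := clOs; rewrite -(cardfsID S1 Os) (fsetIidPr S1Os).
by rewrite leq_add // -(leq_pmul2l (isT : 0 < 2)%N).
Qed.

(** Saturation for the whole family [Os] starts the count at no more than [2 * k]; after [i] rounds
    the excess over [k] is at most [2 * k / 2 ^ i < 1], so none is left. *)
Lemma radcost_run i : (2 * k < 2 ^ i)%N -> (k <= #|` X|)%N ->
  radcost N (Cs k) < v * (1 + 2 * i%:R).
Proof.
move=> ki kX; have v0 : 0 < v := lt_trans r0 rv.
pose q i := #|` P_ (tau + 2 * v * i%:R)|.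
have ti j : tau <= tau + 2 * v * j%:R by rewrite lerDl !mulr_ge0 // ltW.
have halve j : (2 * q j.+1 <= q j + k)%N.
  have s0 := lt_le_trans tau0 (ti j).
  have -> : q j.+1 = #|` P_ (tau + 2 * v * j%:R + 2 * v)|.
    by rewrite /q -natr1; congr (#|` P_ _|); ring.
  apply: leq_trans (leq_add (leqnn _) (unmerged_card (ti j))).
  have st : tau + 2 * v * j%:R <= tau + 2 * v * j%:R + 2 * v.
    by rewrite lerDl mulr_ge0 // ltW.
  exact: (stage_card2 s0 st (fsubset_refl _)).
have q0 : (q 0%N <= 2 * k)%N.
  have [cov _ _ cOs] := clOs; rewrite -{1}cOs.
  apply: leq_trans (cntv (fsubset_refl _)).
  rewrite /q mulr0 addr0 /cnt fsubset_leq_card //.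
  apply/fsubsetP => A AP; rewrite !inE AP cov /=.
  exact: clustering_sub (clP tau0) AP.
have := iter_halving i halve => qi.
have s0 := lt_le_trans tau0 (ti i).
have [_ _ _ cq] := clP s0.
have qk : (q i <= k)%N by nia.
apply: (@lt_trans _ _ (tau + 2 * v * i%:R)); last by rewrite /tau; move: r0; lra.
by apply: (stage_radcost Nn run X0 s0); rewrite -cq qk.
Qed.

End Final.

End Analysis.

(** * Logarithms and the explicit constant *)

Lemma ln2_ge_half (R : realType) : 2^-1 <= ln 2 :> R.
Proof.
rewrite -[leLHS]expRK ler_ln ?posrE ?expR_gt0 //.
have E0 := expR_gt0 (2^-1 : R).
(* Multiplying [expR (- 1/2) >= 1/2] by [expR (1/2)] gives [expR (1/2) <= 2]. *)
have := ler_wpM2l (ltW E0) (expR_ge1Dx (- 2^-1 : R)).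
by rewrite expRN divff ?gt_eqF //; lra.
Qed.

Lemma trunc_log2_le_ln (R : realType) (k : nat) :
  (0 < k)%N -> (trunc_log 2 k)%:R <= 2 * ln (k%:R) :> R.
Proof.
move=> k0; have := trunc_logP (isT : 1 < 2)%N k0; set l := trunc_log 2 k => lk.
have : l%:R * ln 2 <= ln (k%:R) :> R.
  rewrite mulr_natl -lnXn // -natrX ler_ln ?posrE ?ltr0n ?expn_gt0 //.
  by rewrite ler_nat.
have := ln2_ge_half R; have : 0 <= l%:R :> R by [].
nra.
Qed.

Lemma singly_exponential_affine (R : realType) (a b : nat) :
  singly_exponential (fun d => (2 ^ (a * d + b))%:R : R).
Proof.
exists (fun d => (a * d + b)%:R); last by move=> d; rewrite natrX powR_mulrn.
apply/eqO_exP; exists (a + b).+1%:R => //.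
(* Starting at [d = 1] lets [b] be absorbed into [b * d]. *)
exists 1%N => // d /= d1.
by rewrite !normr_nat -natrM ler_nat; nia.
Qed.

Section Bound.
Variables (R : realType) (d : nat) (N : 'rV[R]_d -> R) (X : {fset 'rV[R]_d}).
Variable Cs : nat -> {fset {fset 'rV[R]_d}}.
Hypotheses (Nn : is_norm N) (run : agglomerative_run N X Cs).
Variable k : nat.
Hypothesis kX : (0 < k <= #|` X|)%N.

Lemma opt_ge0 : 0 <= opt N X k.
Proof.
apply: lb_le_inf; last by move=> _ [P _ <-]; exact: radcost_ge0.
exists (radcost N (Cs k)), (Cs k) => //.
exact (run_clustering run kX).
Qed.

(** A strict upper bound [r] on the infimum supplies an actual clustering of cost below [r], and it
    is positive even when the optimum is 0. *)
Lemma radcost_le_of_opt_lt r : opt N X k < r ->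
  radcost N (Cs k) <= (2 ^ (7 * d + 16))%:R * (1 + ln (k%:R)) * r.
Proof.
move=> opt_r; have r0 : 0 < r := le_lt_trans opt_ge0 opt_r.
have /andP[k0 kleX] := kX; have X0 := leq_trans k0 kleX.
have clk := run_clustering run kX.
have [|_ [Os clOs <-] Os_lt] := inf_lt _ opt_r.
  by exists (radcost N (Cs k)), (Cs k).
have [v /andP[rv vle] cntv] := saturation Nn run X0 r0 Os_lt.
set i := (trunc_log 2 k).+2.
have ki : (2 * k < 2 ^ i)%N.
  by rewrite expnS ltn_pmul2l // trunc_log_ltn.
have := radcost_run Nn run X0 r0 clOs Os_lt rv cntv ki kleX => /ltW/le_trans; apply.
(* The left side is [5 + 2 * trunc_log 2 k], at most [5 + 4 * ln k]. *)
have logk : 1 + 2 * i%:R <= 8 * (1 + ln (k%:R)) :> R.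
  have := trunc_log2_le_ln R k0.
  have : 0 <= ln (k%:R) :> R by rewrite ln_ge0 // ler1n.
  by rewrite /i -!natr1; lra.
(* Rounding 3 up to [2^2] and 6 up to [2^3], the exponents add up to
   [2(2d+3) + 3(d+2) + 1 + 3 = 7d + 16]. *)
have vle2 : v * 8 <= (2 ^ (7 * d + 16))%:R * r.
  have le3 : 3 ^+ (2 * d.+1).+1 <= 4 ^+ (2 * d.+1).+1 :> R.
    by rewrite lerXn2r ?nnegrE // ler_nat.
  have le6 : 6 ^+ d.+2 <= 8 ^+ d.+2 :> R by rewrite lerXn2r ?nnegrE // ler_nat.
  apply: (@le_trans _ _ (4 ^+ (2 * d.+1).+1 * (8 ^+ d.+2 * (2 * r)) * 8)).
    rewrite ler_wpM2r // (le_trans vle) //.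
    have r2 : 0 <= 2 * r by rewrite mulr_ge0 // ltW.
    apply: ler_pM => //; first by rewrite mulr_ge0.
    by rewrite ler_wpM2r.
  rewrite le_eqVlt; apply/orP; left; apply/eqP.
  have -> : (4 = 2 ^+ 2 :> R) by rewrite -natrX.
  have -> : (8 = 2 ^+ 3 :> R) by rewrite -natrX.
  rewrite natrX -!exprM.
  have -> : (7 * d + 16 = 2 * (2 * d.+1).+1 + 3 * d.+2 + 1 + 3)%N by lia.
  by rewrite !exprD expr1; ring.
have v0 := lt_trans r0 rv;
apply: le_trans (ler_wpM2l (ltW v0) logk) _.
rewrite mulrA [leRHS]mulrAC ler_wpM2r //.
by rewrite addr_ge0 // ln_ge0 // ler1n.
Qed.

End Bound.

Theorem theorem2 (R : realType) :
  exists2 c : nat -> R, singly_exponential c &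
    forall (d : nat) (N : 'rV[R]_d -> R), is_norm N ->
    forall (X : {fset 'rV[R]_d}) (Cs : nat -> {fset {fset 'rV[R]_d}}),
      agglomerative_run N X Cs ->
    forall k : nat, (0 < k <= #|` X|)%N ->
      radcost N (Cs k) <= c d * (1 + ln (k%:R)) * opt N X k.
Proof.
exists (fun d => (2 ^ (7 * d + 16))%:R); first exact: singly_exponential_affine.
move=> d N Nn X Cs run k kX; set A := _ * (1 + _).
have A0 : 0 < A.
  have /andP[k0 _] := kX.
  by rewrite mulr_gt0 ?ltr0n ?expn_gt0 // ltr_pwDl // ln_ge0 // ler1n.
(* The choice [r = opt N X k + e / A] makes the error exactly [e]. *)
apply/ler_addgt0Pr => e e0.
have := radcost_le_of_opt_lt Nn run kX (r := opt N X k + e / A).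
rewrite ltrDl divr_gt0 // => /(_ isT); rewrite -/A mulrDr.
by rewrite [A * (e / A)]mulrC divfK // gt_eqF.
Qed.
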